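(* Let $\alpha$ be a parameter and let $\lambda$ be a non-empty partition. Then $$F_{\lambda}\, l_{\lambda}^{(\alpha)}(x) = \sum_{\mu \lessdot \lambda} \bigl(x+\alpha-c(\lambda/\mu)\bigr) F_{\mu}\, l_{\mu}^{(\alpha)}(x) + x\,(|\lambda|-1) \sum_{\rho \in \mathcal{R}_2^{-}(\lambda)} (-1)^{\operatorname{ht}(\lambda/\rho)} F_{\rho}\, l_{\rho}^{(\alpha)}(x),$$ where $l_\lambda^{(\alpha)}$ denotes the Wronskian (modified) Laguerre polynomial associated to $\lambda$, $F_\lambda$ is the number of directed paths from $\emptyset$ to $\lambda$ in the Young lattice, $c(\lambda/\mu)$ is the content of the box $\lambda/\mu$, and $\mathcal{R}_2^{-}(\lambda)$ is the set of partitions obtained from $\lambda$ by removing a domino.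
   Context: **Partitions.** A partition is a finite (possibly empty) sequence $\lambda=(\lambda_1,\dots,\lambda_r)$ of integers with $\lambda_1\ge\lambda_2\ge\dots\ge\lambda_r>0$; its length is $\ell(\lambda)=r$ and its size is $|\lambda|=\sum_i\lambda_i$. Its Young diagram $D_\lambda$ has $r$ rows, row $i$ having $\lambda_i$ boxes. Write $\mu\le\lambda$ if $D_\mu\subseteq D_\lambda$; this order makes the set of partitions into the Young lattice. Write $\mu\lessdot\lambda$ if $\mu\le\lambda$ and $|\lambda|-|\mu|=1$, i.e. $D_\mu$ is obtained from $D_\lambda$ by removing one box. If this box lies in row $i$, the content is $c(\lambda/\mu)=\lambda_i-i$. $\mathcal{R}_2^-(\lambda)$ is the set of partitions $\rho\le\lambda$ such that $D_\lambda\setminus D_\rho$ is a border strip of size 2, i.e. a domino (two edge-adjacent boxes). In this case $\operatorname{ht}(\lambda/\rho)$ is the number of rows occupied by the domino minus 1: it is $0$ if the domino is horizontal and $1$ if it is vertical. The degree vector of $\lambda=(\lambda_1,\dots,\lambda_r)$ is $n_\lambda=(n_1,\dots,n_r)$ with $n_i=\lambda_i+r-i$ for $i=1,\dots,r$. $F_\lambda$ is the number of directed paths in the Young lattice from $\emptyset$ to $\lambda$ (equivalently, the number of standard Young tableaux of shape $\lambda$), with $F_\emptyset=1$; one has $$F_\lambda=\frac{|\lambda|!\,\prod_{i<j}(n_i-n_j)}{\prod_i n_i!}.$$ **Modified Laguerre polynomials.** For a parameter $\alpha$ (a real or complex number), the polynomials $l_n^{(\alpha)}(x)=n!\,L_n^{(\alpha-n)}(-x)$,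 with $L_n^{(\alpha)}$ the classical Laguerre polynomials, are determined by $l_0^{(\alpha)}(x)=1$, $l_1^{(\alpha)}(x)=x+\alpha$ and $$l_n^{(\alpha)}(x)=(x+\alpha-n+1)\,l_{n-1}^{(\alpha)}(x)+x\,(n-1)\,l_{n-2}^{(\alpha)}(x)\qquad(n\ge2).$$ **Wronskian Laguerre polynomials.** For a partition $\lambda=(\lambda_1,\dots,\lambda_r)$ with degree vector $(n_1,\dots,n_r)$, $$l_\lambda^{(\alpha)}=\frac{\operatorname{Wr}[l_{n_1}^{(\alpha)},l_{n_2}^{(\alpha)},\dots,l_{n_r}^{(\alpha)}]}{\prod_{i<j}(n_j-n_i)},$$ where $\operatorname{Wr}$ is the Wronskian determinant with respect to $x$; for the empty partition, $l_\emptyset^{(\alpha)}=1$. *)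

(* Defs.v *)
From HB Require Import structures.
From mathcomp Require Import all_boot all_algebra.
From mathcomp Require Import ring.

Set Implicit Arguments.
Unset Strict Implicit.
Unset Printing Implicit Defensive.

Import GRing.Theory Num.Theory.

Local Open Scope ring_scope.

(** ** Partitions and the Young lattice *)

Definition is_part (s : seq nat) : bool := sorted geq s && (0%N \notin s).

Record intpart := IntPart { parts :> seq nat; _ : is_part parts }.

HB.instance Definition _ := [isSub for parts].
HB.instance Definition _ := [Choice of intpart by <:].

Definition empty_part : intpart := @IntPart [::] isT.

Definition psize (la : intpart) : nat := sumn la.

(** Boxes are (row, column) pairs; rows, columns and parts are numbered
    from 0. *)
Definition diagram (la : intpart) : seq (nat * nat) :=
  [seq (i, j) | i <- iota 0 (size la), j <- iota 0 (nth 0%N la i)].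

Lemma mem_diagram (la : intpart) i j :
  ((i, j) \in diagram la) = (j < nth 0 la i)%N.
Proof.
apply/allpairsPdep/idP => [[i' [j' [_ + [-> ->]]]]|lt_j].
  by rewrite mem_iota.
exists i, j; split=> //; rewrite ?mem_iota //=.
by rewrite add0n ltnNge; apply: contraL lt_j => /(nth_default 0%N) ->.
Qed.

Definition skew_diagram (la mu : intpart) : seq (nat * nat) :=
  [seq b <- diagram la | b \notin diagram mu].

Definition young_le (mu la : intpart) : bool :=
  all [in diagram la] (diagram mu).

Lemma young_leP (mu la : intpart) :
  reflect (forall i, (nth 0 mu i <= nth 0 la i)%N) (young_le mu la).
Proof.
apply: (iffP allP) => [le_mu i | le_mu [i j]].
  case E: (nth 0%N mu i) => [//|j].
  by have := le_mu (i, j); rewrite /= !mem_diagram E; apply.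
by rewrite /= !mem_diagram => /leq_trans; apply.
Qed.

Definition young_cover (mu la : intpart) : bool :=
  young_le mu la && (psize la == (psize mu).+1).

Definition edge_adjacent (b c : nat * nat) : bool :=
  [|| (b.1 == c.1) && ((c.2 == b.2.+1) || (b.2 == c.2.+1))
    | (b.2 == c.2) && ((c.1 == b.1.+1) || (b.1 == c.1.+1))].

Definition domino (s : seq (nat * nat)) : bool :=
  if s is [:: b; c] then edge_adjacent b c else false.

(** [domino_cover rho la] is membership of [rho] in R_2^-([la]). *)
Definition domino_cover (rho la : intpart) : bool :=
  young_le rho la && domino (skew_diagram la rho).

Definition height (la rho : intpart) : nat :=
  (size (undup [seq b.1 | b <- skew_diagram la rho])).-1.

(** The content [la_i - i] counts rows from 1, whereas [i] below is the
    0-based row of the box; only meaningful when [young_cover mu la]. *)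
Definition content (la mu : intpart) : int :=
  let i := (head (0%N, 0%N) (skew_diagram la mu)).1 in
  (nth 0%N la i)%:Z - i.+1%:Z.

Fixpoint seqs_below (s : seq nat) : seq (seq nat) :=
  if s is a :: s' then
    [::] :: [seq x :: t | x <- iota 1 a, t <- seqs_below s']
  else [:: [::]].

(** Duplicate-free enumeration of the partitions [mu <= la]: see
    [mem_young_ideal] and [uniq_young_ideal]. *)
Definition young_ideal (la : intpart) : seq intpart :=
  pmap insub (seqs_below la).

Lemma mem_seqs_below (s t : seq nat) :
  reflect (0%N \notin t /\ forall i, (nth 0 t i <= nth 0 s i)%N)
          (t \in seqs_below s).
Proof.
elim: s t => [|a s IHs] [|x t] /=.
- by rewrite inE eqxx; constructor; split=> // i; rewrite nth_nil.
- rewrite mem_seq1; constructor=> -[]; rewrite in_cons negb_or eq_sym.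
  by move=> /andP[x0 _] /(_ 0%N) /=; rewrite leqn0 (negPf x0).
- by rewrite inE eqxx; constructor; split=> // i; rewrite nth_nil.
rewrite [x :: t \in _]in_cons /=; apply: (iffP allpairsP).
  move=> [[y u] /= [+ + [-> ->]]]; rewrite mem_iota add1n ltnS.
  move=> /andP[y_gt0 le_y] /IHs[u0 le_u]; split; last by case.
  by rewrite in_cons negb_or u0 eq_sym -lt0n y_gt0.
rewrite in_cons negb_or eq_sym -lt0n => -[/andP[x0 t0] le_t].
exists (x, t); split=> //=; first by rewrite mem_iota x0 add1n ltnS (le_t 0%N).
by apply/IHs; split=> // i; apply: (le_t i.+1).
Qed.

Lemma mem_young_ideal (la mu : intpart) :
  (mu \in young_ideal la) = young_le mu la.
Proof.
rewrite mem_pmap_sub /=; apply/mem_seqs_below/young_leP => [[]//|le_mu].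
by split=> //; case: (mu) => s /= /andP[].
Qed.

Lemma uniq_young_ideal (la : intpart) : uniq (young_ideal la).
Proof.
apply: pmap_sub_uniq; elim: (la : seq nat) => [//|a s IHs] /=.
apply/andP; split; first by apply/negP => /allpairsP[[]] ? ? [].
by apply: allpairs_uniq => //; [apply: iota_uniq | move=> [? ?] [? ?] _ _ [-> ->]].
Qed.

(** [p] lists the vertices after the initial one, [empty_part]. *)
Definition young_path (la : intpart) (p : seq intpart) : bool :=
  path young_cover empty_part p && (last empty_part p == la).

Lemma young_path_bound (la : intpart) (p : seq intpart) :
  young_path la p ->
  size p = psize la /\ {subset p <= young_ideal la}.
Proof.
case/andP; elim/last_ind: p la => [|p mu IHp] la.
  by move=> _ /eqP <-.
rewrite rcons_path last_rcons => /andP[p_path /andP[le_mu /eqP sz]] /eqP <-.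
have [szp sub_p] := IHp _ p_path (eqxx _); split.
  by rewrite size_rcons szp sz.
move=> nu; rewrite mem_rcons inE mem_young_ideal => /orP[/eqP ->|/sub_p].
  exact/young_leP.
rewrite mem_young_ideal => /young_leP le1; apply/young_leP => i.
by apply: leq_trans (le1 i) _; apply/young_leP.
Qed.

(** By [young_path_bound] every path from the empty partition to [la] has
    [psize la] steps and stays in [young_ideal la], so this counts all paths. *)
Definition nb_paths (la : intpart) : nat :=
  #|[set p : (psize la).-tuple (seq_sub (young_ideal la))
      | young_path la (map val p)]|.

(** ** Laguerre polynomials *)

(** L_n^(a)(x) = \sum_(k <= n) (-1)^k binom(n + a, n - k) x^k / k!, where
    binom(n + a, m) = (n + a)(n + a - 1)...(n + a - m + 1) / m!. *)
Definition gbinom (R : numFieldType) (a : R) (m : nat) : R :=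
  (\prod_(i < m) (a - i%:R)) / (m`!)%:R.

Definition laguerre (R : numFieldType) (a : R) (n : nat) : {poly R} :=
  \poly_(k < n.+1) ((-1) ^+ k * gbinom (n%:R + a) (n - k) / (k`!)%:R).

Definition mod_laguerre (R : numFieldType) (alpha : R) (n : nat) : {poly R} :=
  (n`!)%:R *: (laguerre (alpha - n%:R) n \Po - 'X).

Lemma coef_mod_laguerre (R : numFieldType) (alpha : R) n k :
  (mod_laguerre alpha n)`_k =
    ('C(n, k))%:R * \prod_(i < n - k) (alpha - i%:R).
Proof.
rewrite coefZ.
have -> : (laguerre (alpha - n%:R) n \Po - 'X)`_k
          = (-1) ^+ k * (laguerre (alpha - n%:R) n)`_k.
  rewrite -scaleN1r comp_polyE coef_sum.
  under eq_bigr => i _ do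
    rewrite coefZ exprZn coefZ coefXn.
  have [lt_k|ge_k] := ltnP k (size (laguerre (alpha - n%:R) n)).
    rewrite (bigD1 (Ordinal lt_k)) //= eqxx mulr1 big1 ?addr0 1?mulrC // => i ne.
    case: eqP => [ki|_]; last by rewrite !mulr0.
    by case/eqP: ne; apply: val_inj.
  rewrite nth_default // mulr0 big1 // => i _.
  by rewrite gtn_eqF ?mulr0 // (leq_trans (ltn_ord i)).
rewrite coef_poly ltnS; case: leqP => [le_k|lt_k]; last first.
  by rewrite bin_small // !mulr0 mul0r.
have fact_neq0 m : (m`!)%:R != 0 :> R by rewrite pnatr_eq0 -lt0n fact_gt0.
rewrite -(bin_fact le_k) !natrM /gbinom addrC subrK.
have sign2 : (-1) ^+ k * (-1) ^+ k = 1 :> R by rewrite -expr2 sqrr_sign.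
rewrite 2![(-1) ^+ k * (_ * _)]mulrA sign2 mul1r.
by field; rewrite !fact_neq0.
Qed.

Lemma mod_laguerre0 (R : numFieldType) (alpha : R) : mod_laguerre alpha 0 = 1.
Proof.
apply/polyP=> k; rewrite coef_mod_laguerre coef1 sub0n big_ord0 mulr1.
by case: k.
Qed.

Lemma mod_laguerre1 (R : numFieldType) (alpha : R) :
  mod_laguerre alpha 1 = 'X + alpha%:P.
Proof.
apply/polyP=> k; rewrite coef_mod_laguerre coefD coefX coefC.
case: k => [|[|k]] /=; first by rewrite big_ord1 subr0 mul1r add0r.
  by rewrite big_ord0 mulr1 addr0.
by rewrite mul0r addr0.
Qed.

Lemma mod_laguerreSS (R : numFieldType) (alpha : R) (n : nat) :
  mod_laguerre alpha n.+2 =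
    ('X + (alpha - n.+1%:R)%:P) * mod_laguerre alpha n.+1
    + 'X * n.+1%:R%:P * mod_laguerre alpha n.
Proof.
apply/polyP=> k; rewrite coefD mulrDl coefD coefCM -mulrA !coefXM coefCM.
rewrite !coef_mod_laguerre; case: k => [|k] /=.
  by rewrite !subn0 !bin0 big_ord_recr /= !mul1r add0r addr0 mulrC.
rewrite !subSS binS natrD.
have [lt_nk|le_kn] := ltnP n k.
  by rewrite (bin_small lt_nk) (@bin_small n.+1 k.+1) // !mul0r !mulr0 add0r !addr0.
rewrite subSn // big_ord_recr /=.
have E : (k.+1 * 'C(n.+1, k.+1) = n.+1 * 'C(n, k))%N by rewrite mul_bin_diag.
have {}E : k.+1%:R * 'C(n.+1, k.+1)%:R = n.+1%:R * 'C(n, k)%:R :> R.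
  by rewrite -!natrM E.
rewrite natrB //; set P := \prod_(i < _) _.
have -> : n.+1%:R * ('C(n, k)%:R * P) = k.+1%:R * 'C(n.+1, k.+1)%:R * P.
  by rewrite E mulrA.
rewrite -![_.+1%:R]natr1; ring.
Qed.

(** ** Wronskian Laguerre polynomials *)

Definition degree_vector (la : intpart) (i : 'I_(size la)) : nat :=
  (nth 0 la i + size la - i.+1)%N.

Arguments degree_vector : clear implicits.

Definition wronskian (R : comNzRingType) (r : nat) (f : 'I_r -> {poly R}) :
  {poly R} := \det (\matrix_(i < r, j < r) (f j)^`(i)).

Definition wronskian_laguerre (R : numFieldType) (alpha : R) (la : intpart) :
  {poly R} :=
  (\prod_(i < size la) \prod_(j < size la | (i < j)%N)
      ((degree_vector la j)%:R - (degree_vector la i)%:R))^-1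
    *: wronskian (fun j => mod_laguerre alpha (degree_vector la j)).

Lemma wronskian_laguerre_empty (R : numFieldType) (alpha : R) :
  wronskian_laguerre alpha empty_part = 1.
Proof. by rewrite /wronskian_laguerre /wronskian big_ord0 invr1 scale1r det_mx00. Qed.

(* Main.v *)
Require Import Defs.
From mathcomp Require Import all_boot all_order all_fingroup all_algebra.
From mathcomp Require Import ring zify.

(** With [g_n = l_n / n!] one has [g_n' = g_(n-1)], so the Wronskian of the
    [g_(n_j)] is, up to reversing its rows, the Jacobi-Trudi determinant
    [s_la = det (g_(la_j - j + i))], where [g_m = 0] for [m < 0].  Any sequence
    with [z h_z = (a - b (z - 1)) h_(z-1) + c h_(z-2)] satisfies
    [|la| s_la = \sum_mu (a - b c(la/mu)) s_mu + c \sum_rho (-1)^ht s_rho]: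
    lowering one column index by 1 or 2 gives, after sorting the columns, either
    0 or the partition with one box or one domino removed.  For [h_n = 1/n!]
    ([a = 1], [b = c = 0]) this is the recurrence of [F_la / |la|!], whence
    [F_la = |la|! det (1 / (la_j - j + i)!)]; that determinant is the Vandermonde
    product of the degree vector divided by [\prod n_j!], which is the
    normalization of [l_la], so [F_la l_la = |la|! s_la] for [h = g].  The
    theorem is then the recurrence for [h = g] ([a = x + alpha], [b = 1],
    [c = x]) multiplied by [(|la| - 1)!]. *)

Set Implicit Arguments.
Unset Strict Implicit.
Unset Printing Implicit Defensive.

Import Order.TTheory GRing.Theory Num.Theory.

Local Open Scope ring_scope.

Implicit Types la mu rho : intpart.

(** * Jacobi-Trudi determinants *)

Definition ext0 (A : nmodType) (h : nat -> A) (z : int) : A :=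
  if z is Posz n then h n else 0.

(* For a partition [la], [v j] is [la_j - j] with 0-based [j]. *)
Definition jacobi_trudi (A : comNzRingType) (h : nat -> A) (r : nat)
    (v : nat -> int) : A :=
  \det (\matrix_(i < r, j < r) ext0 h (v j + i%:Z)).

Definition lower (v : nat -> int) (j : nat) (d : int) (k : nat) : int :=
  v k - (if k == j then d else 0).

Section Recurrence.
Variables (A : comNzRingType) (h : nat -> A) (a b c : A).
Hypothesis h1 : h 1 = a * h 0.
Hypothesis hSS : forall n,
  n.+2%:R * h n.+2 = (a - b * n.+1%:R) * h n.+1 + c * h n.

Local Notation H := (ext0 h).

(** Extension by zero carries the recurrence to all integers: both sides vanish for [z <= 0], and
    [z = 1] is [h1] because [H] is 0 at -1. *)
Lemma ext0_rec (z : int) :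
  z%:~R * H z = (a - b * (z - 1)%:~R) * H (z - 1) + c * H (z - 2).
Proof.
case: z => [[|[|n]]|n].
- by rewrite mul0r /= !mulr0 addr0.
- have -> : 1%:Z - 1 = 0 by []. have -> : 1%:Z - 2 = Negz 0 by [].
  by rewrite /= !mulr0 subr0 addr0 mul1r.
- have -> : n.+2%:Z - 1 = n.+1 by lia.
  have -> : n.+2%:Z - 2 = n by lia.
  exact: hSS.
- have -> : Negz n - 1 = Negz n.+1 by lia.
  have -> : Negz n - 2 = Negz n.+2 by lia.
  by rewrite /= !mulr0 addr0.
Qed.

(** Lowering changes column [j] only, so expansion along it uses the cofactors of the original
    matrix. *)
Lemma jacobi_trudi_lower (r : nat) (v : nat -> int) (j : 'I_r) (d : int) :
  jacobi_trudi h r (lower v j d) =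
  \sum_(i < r) H (v j - d + i%:Z)
    * cofactor (\matrix_(i < r, j < r) H (v j + i%:Z)) i j.
Proof.
rewrite /jacobi_trudi (expand_det_col _ j); apply: eq_bigr => i _.
rewrite mxE /lower eqxx; congr (_ * _).
rewrite /cofactor; congr (_ * \det _); apply/matrixP => k l; rewrite !mxE.
by rewrite (_ : (_ == _) = false) ?subr0 // eq_sym; apply/negbTE/neq_lift.
Qed.

(* Multiply the recurrence for the (i, j) entry by its cofactor and sum.  The
   row weights i contribute \sum i on the left; on the right they pair row
   i - 1 with the cofactors of row i, which gives 0. *)
Lemma jacobi_trudi_rec (r : nat) (v : nat -> int) :
  (\sum_(j < r) (v j + j%:Z))%:~R * jacobi_trudi h r v =
  \sum_(j < r) (a - b * (v j - 1)%:~R) * jacobi_trudi h r (lower v j 1)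
  + c * \sum_(j < r) jacobi_trudi h r (lower v j 2).
Proof.
pose M := \matrix_(i < r, j < r) H (v j + i%:Z).
pose C (i j : 'I_r) := cofactor M i j.
have row_shift : \sum_(j < r) \sum_(i < r) i%:R * (H (v j - 1 + i%:Z) * C i j) = 0.
  rewrite exchange_big big1 //= => i _; rewrite -mulr_sumr.
  case: i => -[|i] lt_i /=; first by rewrite mul0r.
  have lt_i' := ltnW lt_i.
  have /matrixP/(_ (Ordinal lt_i') (Ordinal lt_i)) := mul_mx_adj M.
  rewrite !mxE -val_eqE /= eqn_leq ltnn andbF mulr0n => E.
  rewrite [X in _ * X](_ : _ = 0) ?mulr0 // -[RHS]E; apply: eq_bigr => j _.
  by rewrite !mxE /=; congr (H _ * _); lia.
transitivity (\sum_(j < r) \sum_(i < r) (v j + i%:Z)%:~R * (H (v j + i%:Z) * C i j)).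
  (* The weight [v j + i] splits: the parts [v j] are collected by expansion along columns, the
     parts [i] by expansion along rows. *)
  transitivity (\sum_(j < r) (v j)%:~R * jacobi_trudi h r v
                + \sum_(i < r) i%:R * jacobi_trudi h r v).
    rewrite -!mulr_suml -mulrDl; congr (_ * _); rewrite big_split /= intrD.
    by rewrite !rmorph_sum.
  rewrite (_ : \sum_(i < r) i%:R * _
             = \sum_(j < r) \sum_(i < r) i%:R * (H (v j + i%:Z) * C i j)); last first.
    rewrite [RHS]exchange_big /=; apply: eq_bigr => i _; rewrite -mulr_sumr; congr (_ * _).
    rewrite /jacobi_trudi (expand_det_row _ i); apply: eq_bigr => j _.
    by rewrite mxE.
  rewrite -big_split /=; apply: eq_bigr => j _.
  rewrite /jacobi_trudi (expand_det_col _ j) mulr_sumr -big_split /=.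
  by apply: eq_bigr => i _; rewrite mxE intrD mulrDl.
(* At [z = v j + i] the recurrence has the coefficient [a - b * (v j - 1 + i)]; adding [b] times the
   zero sum [row_shift] removes the part [b * i]. *)
have {}row_shift := congr1 (fun s => b * s) row_shift; rewrite mulr0 in row_shift.
rewrite -[LHS]addr0 -[X in _ + X = _]row_shift.
rewrite !mulr_sumr -!big_split /=; apply: eq_bigr => j _.
rewrite !jacobi_trudi_lower !mulr_sumr -!big_split /=.
apply: eq_bigr => i _; rewrite -/M -/(C i j) [_ * (H (v j + _) * _)]mulrA ext0_rec.
have -> : v j + i%:Z - 1 = v j - 1 + i%:Z by ring.
have -> : v j + i%:Z - 2 = v j - 2 + i%:Z by ring.
rewrite [(v j - 1 + _)%:~R]intrD; ring.
Qed.

End Recurrence.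

(** * Vanishing, exchange and padding of columns *)

Section Degenerate.
Variables (A : comNzRingType) (h : nat -> A).

Lemma eq_jacobi_trudi (r : nat) (v w : nat -> int) :
  (forall j, (j < r)%N -> v j = w j) -> jacobi_trudi h r v = jacobi_trudi h r w.
Proof.
by move=> eq_vw; congr (\det _); apply/matrixP => i j; rewrite !mxE eq_vw.
Qed.

Lemma jacobi_trudi_eq0 (r : nat) (v : nat -> int) (j k : nat) :
  (j < r)%N -> (k < r)%N -> j != k -> v j = v k -> jacobi_trudi h r v = 0.
Proof.
move=> ltj ltk neq_jk eq_v; rewrite /jacobi_trudi -det_tr.
apply: (@determinant_alternate _ _ _ (Ordinal ltj) (Ordinal ltk)) => // i.
by rewrite !mxE /= eq_v.
Qed.

(** Even the last row has index [v j + r - 1 < 0], so column [j] is zero. *)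
Lemma jacobi_trudi_neg (r : nat) (v : nat -> int) (j : nat) :
  (j < r)%N -> v j + r%:Z <= 0 -> jacobi_trudi h r v = 0.
Proof.
move=> ltj v_neg; rewrite /jacobi_trudi (expand_det_col _ (Ordinal ltj)).
rewrite big1 // => i _; rewrite mxE /=; have := ltn_ord i.
by case E: (v j + i%:Z) => [n|n]; [lia|rewrite mul0r].
Qed.

Lemma jacobi_trudi_swap (r : nat) (v w : nat -> int) (j k : nat) :
  (j < r)%N -> (k < r)%N -> j != k -> w j = v k -> w k = v j ->
  (forall l, l != j -> l != k -> w l = v l) ->
  jacobi_trudi h r w = - jacobi_trudi h r v.
Proof.
move=> ltj ltk neq_jk wj wk wl; pose oj := Ordinal ltj; pose ok := Ordinal ltk.
rewrite /jacobi_trudi.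
have -> : \matrix_(i < r, l < r) ext0 h (w l + i%:Z)
        = xcol oj ok (\matrix_(i < r, l < r) ext0 h (v l + i%:Z)).
  apply/matrixP => i l; rewrite !mxE; congr (ext0 h (_ + _)).
  case: tpermP => [->|->|/eqP nj /eqP nk] //; exact: wl.
rewrite xcolE det_mulmx det_perm odd_tperm.
by rewrite -val_eqE /= neq_jk expr1 mulrN1.
Qed.

Hypothesis h0 : h 0 = 1.

(** An entry of an extra column [j] is [ext0 h (i - j)]: 0 above the diagonal and [h 0 = 1] on it,
    so expansion along the last column deletes it. Trailing zero parts thus leave the determinant
    unchanged. *)
Lemma jacobi_trudi_widen (r n : nat) (v : nat -> int) :
  (forall j, (r <= j < n + r)%N -> v j = - j%:Z) ->
  jacobi_trudi h (n + r) v = jacobi_trudi h r v.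
Proof.
elim: n => // n IHn v_tail; rewrite -[RHS]IHn => [|j lt_j]; last by apply: v_tail; lia.
rewrite /jacobi_trudi addSn (expand_det_col _ ord_max) big_ord_recr /= big1 => [|i _].
  rewrite mxE v_tail /=; last by lia.
  rewrite addNr /= h0 add0r mul1r /cofactor -signr_odd oddD addbb mul1r.
  congr (\det _); apply/matrixP => i j; rewrite !mxE.
  by congr (ext0 h (v _ + Posz _)); rewrite /= /bump leqNgt ltn_ord.
rewrite mxE v_tail /=; last by lia.
case E: (_ + _) => [m|m]; last by rewrite mul0r.
by have := ltn_ord i; lia.
Qed.

End Degenerate.

(** * Boxes and dominoes in terms of row lengths *)

Section Rows.
Local Open Scope nat_scope.

Lemma nth_part_anti la i j : i <= j -> nth 0 la j <= nth 0 la i.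
Proof.
move=> le_ij; have [lt_j|ge_j] := ltnP j (size la); last by rewrite nth_default.
case: la lt_j => s /= /andP[s_sorted _] lt_j.
by apply: (sorted_leq_nth (rev_trans leq_trans)) => //; rewrite inE; apply: leq_ltn_trans lt_j.
Qed.

Lemma nth_part_gt0 la i : (0 < nth 0 la i) = (i < size la).
Proof.
have [lt_i|ge_i] := ltnP i (size la); last by rewrite nth_default.
case: la lt_i => s /= /andP[_ s0] lt_i; rewrite lt0n.
by apply: contra s0 => /eqP <-; apply: mem_nth.
Qed.

Lemma part_ext la mu : (forall i, nth 0 la i = nth 0 mu i) -> la = mu.
Proof.
move=> eq_rows; apply/val_inj/(@eq_from_nth _ 0) => //=.
apply/eqP; rewrite eqn_leq; apply/andP; split; rewrite leqNgt.
  by apply/negP; rewrite -(nth_part_gt0 la) eq_rows nth_part_gt0 ltnn.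
by apply/negP; rewrite -(nth_part_gt0 mu) -eq_rows nth_part_gt0 ltnn.
Qed.

Lemma young_le_size la mu : young_le mu la -> size mu <= size la.
Proof.
move=> /young_leP le_mu; rewrite leqNgt -(nth_part_gt0 mu) -leqNgt.
by apply: leq_trans (le_mu _) _; rewrite nth_default.
Qed.

Definition of_rows (f : nat -> nat) (r : nat) : intpart :=
  insubd empty_part [seq x <- mkseq f r | x != 0].

(** In a weakly decreasing sequence the zeros come last, so deleting them moves no other entry. *)
Lemma nth_of_rows (f : nat -> nat) (r : nat) :
  (forall i, f i.+1 <= f i) -> f r = 0 -> forall i, nth 0 (of_rows f r) i = f i.
Proof.
move=> f_anti fr0.
have f_mono i j : i <= j -> f j <= f i.
  by elim: j => [|j IHj]; [case: i | rewrite leq_eqVlt => /predU1P[->//|/IHj/(leq_trans _)->]].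
have nth_filter0 s i : sorted geq s -> nth 0 [seq x <- s | x != 0] i = nth 0 s i.
  elim: s i => //= x s IHs i s_sorted; case: (posnP x) => [x0|x_gt0] /=.
    have all0 y : y \in s -> y = 0.
      move: s_sorted; rewrite (path_sortedE (rev_trans leq_trans)) x0.
      by move=> /andP[/allP le_s _] /le_s /=; lia.
    rewrite IHs ?(path_sorted s_sorted) // x0.
    have nth0 k : nth 0 s k = 0.
      by have [/(mem_nth 0)/all0|/(nth_default 0)] := ltnP k (size s).
    by case: i => [|i] /=; rewrite !nth0.
  by case: i => //= i; rewrite IHs // (path_sorted s_sorted).
have srt : sorted geq (mkseq f r).
  apply/(sortedP 0) => i; rewrite size_mkseq => lt_i.
  by rewrite !nth_mkseq; [exact: f_anti | exact: lt_i | exact: ltnW].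
move=> i; rewrite /of_rows val_insubd /is_part.
rewrite sorted_filter //=; last exact: rev_trans leq_trans.
rewrite mem_filter eqxx /= nth_filter0 //.
have [lt_i|ge_i] := ltnP i r; first by rewrite nth_mkseq.
rewrite nth_default ?size_mkseq //; have := f_mono _ _ ge_i; lia.
Qed.

Lemma mem_skew la mu i j :
  ((i, j) \in skew_diagram la mu) = (nth 0 mu i <= j < nth 0 la i).
Proof. by rewrite mem_filter !mem_diagram -leqNgt. Qed.

Lemma uniq_diagram la : uniq (diagram la).
Proof.
apply: allpairs_uniq_dep; first exact: iota_uniq.
  by move=> i _; apply: iota_uniq.
by move=> [i j] [k l] _ _ [-> ->].
Qed.

Lemma uniq_skew la mu : uniq (skew_diagram la mu).
Proof. exact/filter_uniq/uniq_diagram. Qed.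

Lemma psize_skew la mu :
  young_le mu la -> psize la = psize mu + size (skew_diagram la mu).
Proof.
have size_diagram nu : size (diagram nu) = psize nu.
  rewrite size_allpairs_dep /psize; congr sumn.
  by under eq_map do rewrite size_iota; rewrite map_nth_iota0 // take_size.
move=> /allP le_mu; rewrite -!size_diagram -(count_predC [in diagram mu]).
congr addn; last by rewrite size_filter.
rewrite -size_filter; apply/perm_size/uniq_perm; rewrite ?filter_uniq ?uniq_diagram //.
by move=> b; rewrite mem_filter; apply: andb_idr => /le_mu.
Qed.

Lemma cover_skew mu la j :
  nth 0 la j.+1 < nth 0 la j -> (forall i, nth 0 mu i = nth 0 la i - (i == j)) ->
  skew_diagram la mu = [:: (j, (nth 0 la j).-1)].
Proof.
move=> valid_j rows_mu; apply: perm_small_eq => //; apply: uniq_perm => //.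
  exact: uniq_skew.
move=> [x y]; rewrite mem_skew inE xpair_eqE rows_mu.
by case: (x =P j) => [->|_] /=; lia.
Qed.

(** The size condition leaves a single skew box, at the end of its row [j]; that row must exceed the
    next one for [mu] to be weakly decreasing. *)
Lemma young_coverP mu la :
  reflect (exists2 j, nth 0 la j.+1 < nth 0 la j &
             forall i, nth 0 mu i = nth 0 la i - (i == j))
          (young_cover mu la).
Proof.
apply: (iffP andP) => [[le_mu /eqP sz]|[j valid_j rows_mu]]; last first.
  have le_mu : young_le mu la by apply/young_leP => i; rewrite rows_mu leq_subr.
  by rewrite (psize_skew le_mu) (cover_skew valid_j rows_mu) addn1.
have := psize_skew le_mu; rewrite sz -addn1 => /addnI.
move/young_leP: le_mu => le_mu; have skewP := mem_skew la mu.
case E: skew_diagram => [|[j y] [|? ?]] //= _; rewrite {}E in skewP.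
have {}skewP i k : (nth 0 mu i <= k < nth 0 la i) = (i == j) && (k == y).
  by rewrite -skewP inE xpair_eqE.
have rows_mu i : nth 0 mu i = nth 0 la i - (i == j).
  move: (skewP i y) (skewP i (nth 0 mu i)) (skewP i (nth 0 la i).-1) (le_mu i).
  by case: eqP => _ /=; lia.
exists j => //; have := nth_part_anti mu (leqnSn j).
have := skewP j y; rewrite !rows_mu !eqxx /= (gtn_eqF (ltnSn _)); lia.
Qed.

Lemma cover_content mu la j :
  nth 0 la j.+1 < nth 0 la j -> (forall i, nth 0 mu i = nth 0 la i - (i == j)) ->
  content la mu = ((nth 0%N la j)%:Z - j%:Z - 1)%R.
Proof.
by move=> valid_j rows_mu; rewrite /content (cover_skew valid_j rows_mu) /=; lia.
Qed.

(* A domino whose upper or left box has row [j] is vertical exactly when rows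
   [j] and [j + 1] of [la] have equal length. *)
Definition domino_rows la (j i : nat) : nat :=
  if nth 0 la j == nth 0 la j.+1 then nth 0 la i - ((i == j) || (i == j.+1))
  else nth 0 la i - (i == j).*2.

(** Exactly the condition for [domino_rows la j] to be weakly decreasing with two boxes fewer than
    [la]. *)
Definition removable_domino la (j : nat) : bool :=
  if nth 0 la j == nth 0 la j.+1 then nth 0 la j.+2 < nth 0 la j
  else nth 0 la j.+1 + 2 <= nth 0 la j.

Lemma domino_rows_skew rho la j :
  removable_domino la j -> (forall i, nth 0 rho i = domino_rows la j i) ->
  perm_eq (skew_diagram la rho)
    (if nth 0 la j == nth 0 la j.+1
     then [:: (j, (nth 0 la j).-1); (j.+1, (nth 0 la j).-1)]
     else [:: (j, (nth 0 la j).-2); (j, (nth 0 la j).-1)]).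
Proof.
rewrite /removable_domino /domino_rows; case: ifP => [/eqP eq_j|_] valid_j rows_rho;
  apply: uniq_perm; rewrite ?uniq_skew //=.
- by rewrite andbT inE xpair_eqE; lia.
- move=> [x y]; rewrite mem_skew !inE !xpair_eqE rows_rho.
  case: (x =P j) => [->|_] /=; first lia.
  by case: (x =P j.+1) => [->|_] /=; lia.
- by rewrite andbT inE xpair_eqE; lia.
- move=> [x y]; rewrite mem_skew !inE !xpair_eqE rows_rho.
  by case: (x =P j) => [->|_] /=; lia.
Qed.

Lemma domino_perm s b c : perm_eq s [:: b; c] -> domino s = edge_adjacent b c.
Proof.
case: s => [|x [|y [|z s]]] perm_s; try by have := perm_size perm_s.
have sym u v : edge_adjacent u v = edge_adjacent v u.
  rewrite /edge_adjacent [u.1 == _]eq_sym [u.2 == v.2]eq_sym.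
  by rewrite [(v.2 == _) || _]orbC [(v.1 == _) || _]orbC.
have : x \in [:: b; c] by rewrite -(perm_mem perm_s) mem_head.
move: perm_s; rewrite !inE => /[swap] /orP[] /eqP-> perm_s.
  by move: perm_s; rewrite perm_cons => /(@perm_small_eq _ _ [:: c] isT) [->].
move: perm_s; rewrite perm_sym (perm_catC [:: b] [:: c]) perm_cons.
by move=> /(@perm_small_eq _ _ [:: y] isT) [<-]; rewrite sym.
Qed.

Lemma domino_coverP rho la :
  reflect (exists2 j, removable_domino la j &
             forall i, nth 0 rho i = domino_rows la j i)
          (domino_cover rho la).
Proof.
apply: (iffP andP) => [[/young_leP le_rho dom]|[j valid_j rows_rho]]; last first.
  split; first by apply/young_leP => i; rewrite rows_rho /domino_rows; case: ifP; lia.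
  have := domino_rows_skew valid_j rows_rho.
  move: valid_j; rewrite /removable_domino.
  by case: ifP => _ valid_j /domino_perm ->; rewrite /edge_adjacent /=; lia.
have skewP := mem_skew la rho.
(* Listing the upper or left box first reduces the four adjacencies to one vertical and one
   horizontal case. *)
wlog [j [k skewE]] : / exists j k,
    skew_diagram la rho =i [:: (j, k); (j.+1, k)]
    \/ skew_diagram la rho =i [:: (j, k); (j, k.+1)].
  apply; move: dom; case: skew_diagram => [|[x y] [|[z t] [|? ?]]] //=.
  rewrite /edge_adjacent /= => /orP[] /andP[/eqP-> /orP[] /eqP->].
  - by exists z, y; right.
  - by exists z, t; right=> b; rewrite !inE orbC.
  - by exists x, t; left.
  - by exists z, t; left=> b; rewrite !inE orbC.
have rho_anti := nth_part_anti rho; have la_anti := nth_part_anti la.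
case: skewE => skewE.
  have {}skewP i l : (nth 0 rho i <= l < nth 0 la i)
      = ((i == j) || (i == j.+1)) && (l == k).
    by rewrite -skewP skewE !inE !xpair_eqE andb_orl.
  have rows i : nth 0 rho i = nth 0 la i - ((i == j) || (i == j.+1)).
    move: (skewP i k) (skewP i (nth 0 rho i)) (skewP i (nth 0 la i).-1) (le_rho i).
    by case: orb => /=; lia.
  have eq_j : nth 0 la j = nth 0 la j.+1.
    by move: (skewP j k) (skewP j.+1 k) (rows j) (rows j.+1); rewrite !eqxx orbT /=; lia.
  exists j => [|i]; rewrite /removable_domino /domino_rows eq_j eqxx -?eq_j //.
  have := rho_anti _ _ (leqnSn j.+1); rewrite !rows eqxx orbT -eq_j.
  have := skewP j k; rewrite eqxx /=; lia.
have {}skewP i l : (nth 0 rho i <= l < nth 0 la i)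
    = (i == j) && ((l == k) || (l == k.+1)).
  by rewrite -skewP skewE !inE !xpair_eqE andb_orr.
have rows i : nth 0 rho i = nth 0 la i - (i == j).*2.
  move: (skewP i k) (skewP i k.+1) (skewP i (nth 0 rho i)) (skewP i (nth 0 la i).-1) (le_rho i).
  by case: eqP => _ /=; lia.
have lt_j : nth 0 la j.+1 + 2 <= nth 0 la j.
  have := rho_anti _ _ (leqnSn j); rewrite !rows eqxx.
  by move: (skewP j k) (skewP j k.+1); rewrite eqxx /=; lia.
have /negbTE neq_j : nth 0 la j != nth 0 la j.+1 by lia.
by exists j; rewrite /removable_domino /domino_rows neq_j.
Qed.

Lemma domino_psize rho la j :
  removable_domino la j -> (forall i, nth 0 rho i = domino_rows la j i) ->
  psize la = psize rho + 2.
Proof.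
move=> valid_j rows_rho; rewrite (@psize_skew _ rho).
  by rewrite (perm_size (domino_rows_skew valid_j rows_rho)); case: ifP.
by apply/young_leP => i; rewrite rows_rho /domino_rows; case: ifP; lia.
Qed.

Lemma domino_height rho la j :
  removable_domino la j -> (forall i, nth 0 rho i = domino_rows la j i) ->
  height la rho = (nth 0 la j == nth 0 la j.+1).
Proof.
move=> valid_j /(domino_rows_skew valid_j) /(perm_map fst) /perm_mem /perm_undup.
rewrite /height => /perm_size ->; case: ifP => _ /=.
  by rewrite inE (ltn_eqF (ltnSn _)).
by rewrite inE eqxx.
Qed.

End Rows.

(** * The recurrence over partitions *)

(** Indexing by the row of the removal treats boxes and dominoes at once: [f j] gives the row
    lengths left by the removal at [j], valid [j] correspond bijectively to the partitions in [P],
    and [T] vanishes at invalid [j]. *)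
Lemma sum_removals (V : nmodType) (la : intpart) (P : pred intpart)
    (valid : pred nat) (f : nat -> nat -> nat) (G : intpart -> V) (T : nat -> V) :
  (forall mu, reflect (exists2 j, valid j & forall i, nth 0%N mu i = f j i) (P mu)) ->
  (forall j i, valid j -> f j i <= nth 0 la i)%N ->
  (forall j, valid j -> f j j < nth 0 la j)%N ->
  (forall j i, valid j -> f j i.+1 <= f j i)%N ->
  (forall j k, valid j -> valid k -> (forall i, f j i = f k i) -> j = k) ->
  (forall j mu, valid j -> (forall i, nth 0%N mu i = f j i) -> T j = G mu) ->
  (forall j, (j < size la)%N -> ~~ valid j -> T j = 0) ->
  \sum_(mu <- young_ideal la | P mu) G mu = \sum_(j < size la) T j.
Proof.
move=> PP f_le f_lt f_anti f_inj T_valid T_invalid.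
pose s := [seq j <- iota 0 (size la) | valid j].
pose mu_ j := of_rows (f j) (size la).
have nth_mu j : valid j -> forall i, nth 0%N (mu_ j) i = f j i.
  move=> valid_j; apply: nth_of_rows => [i|]; first exact: f_anti.
  by have := f_le j (size la) valid_j; rewrite nth_default // leqn0 => /eqP.
have mem_s j : (j \in s) = valid j.
  rewrite mem_filter mem_iota /= add0n; apply: andb_idr => valid_j.
  by rewrite -nth_part_gt0; apply: leq_trans (f_lt j valid_j).
transitivity (\sum_(j <- s) G (mu_ j)).
  rewrite -big_filter -(big_map mu_ predT G); apply/perm_big/uniq_perm.
  - by rewrite filter_uniq ?uniq_young_ideal.
  - rewrite map_inj_in_uniq ?filter_uniq ?iota_uniq // => j k.
    rewrite !mem_s => valid_j valid_k eq_mu; apply: f_inj => // i.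
    by rewrite -!nth_mu // eq_mu.
  move=> mu; rewrite mem_filter mem_young_ideal; apply/andP/mapP.
    move=> [/PP[j valid_j rows_mu] _]; exists j; rewrite ?mem_s //.
    by apply: part_ext => i; rewrite nth_mu.
  move=> [j]; rewrite mem_s => valid_j ->; split.
    by apply/PP; exists j => //; apply: nth_mu.
  by apply/young_leP => i; rewrite nth_mu // f_le.
rewrite big_filter -[iota _ _]/(iota 0 (size la)) -{1}[size la]subn0.
rewrite -/(index_iota 0 (size la)) big_mkord big_mkcond /=.
apply: eq_bigr => j _; case: ifPn => [valid_j|/T_invalid->//].
by rewrite (T_valid _ (mu_ j)) //; apply: nth_mu.
Qed.

Definition schur (A : comNzRingType) (h : nat -> A) (la : intpart) : A :=
  jacobi_trudi h (size la) (fun j => (nth 0%N la j)%:Z - j%:Z).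

Lemma schur_widen (A : comNzRingType) (h : nat -> A) (la : intpart) (r : nat) :
  h 0 = 1 -> (size la <= r)%N ->
  schur h la = jacobi_trudi h r (fun j => (nth 0%N la j)%:Z - j%:Z).
Proof.
move=> h0 le_r; rewrite -(subnK le_r) jacobi_trudi_widen // => j /andP[ge_j _].
by rewrite nth_default // sub0r.
Qed.

Section SchurRecurrence.
Variables (A : comNzRingType) (h : nat -> A) (a b c : A).
Hypothesis h0 : h 0 = 1.
Hypothesis h1 : h 1 = a * h 0.
Hypothesis hSS : forall n,
  n.+2%:R * h n.+2 = (a - b * n.+1%:R) * h n.+1 + c * h n.
Variable la : intpart.

Local Notation r := (size la).
Local Notation row i := (nth 0%N la i).
Let v (j : nat) : int := (row j)%:Z - j%:Z.

(** For a removable box at the end of row [j], [v j - 1] is its content. If that box is not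
    removable, row [j.+1] is equally long, and lowering [v j] by 1 makes it equal to [v j.+1]. *)
Lemma sum_cover_schur :
  \sum_(mu <- young_ideal la | young_cover mu la)
    (a - b * (content la mu)%:~R) * schur h mu
  = \sum_(j < r) (a - b * (v j - 1)%:~R) * jacobi_trudi h r (lower v j 1).
Proof.
apply: (@sum_removals _ la (fun mu => young_cover mu la)
          (fun j => row j.+1 < row j)%N (fun j i => row i - (i == j))%N _
          (fun j => (a - b * (v j - 1)%:~R) * jacobi_trudi h r (lower v j 1))).
- by move=> mu; apply: young_coverP.
- by move=> j i _; lia.
- by move=> j /=; rewrite eqxx; lia.
- move=> j i; have := nth_part_anti la (leqnSn i).
  by case: (i =P j) => [->|_] /=; lia.
- move=> j k lt_j lt_k /(_ j); rewrite eqxx.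
  by case: (j =P k) => //= _; lia.
- move=> j mu valid_j rows_mu; rewrite (cover_content valid_j rows_mu); congr (_ * _).
  rewrite (@schur_widen _ _ _ r) //; last first.
    by apply/young_le_size/young_leP => i; rewrite rows_mu leq_subr.
  apply: eq_jacobi_trudi => i _; rewrite /lower rows_mu /v.
  by case: (i =P j) => [->|_] /=; lia.
move=> j lt_j; rewrite -leqNgt => le_j; rewrite (@jacobi_trudi_eq0 _ _ _ _ j j.+1) ?mulr0 //.
- by rewrite -(nth_part_gt0 la); move: lt_j; rewrite -(nth_part_gt0 la); lia.
- by lia.
- have := nth_part_anti la (leqnSn j).
  by rewrite /lower /v eqxx (gtn_eqF (ltnSn _)); lia.
Qed.

(** If row [j] exceeds row [j.+1] by at least 2, lowering gives a horizontal domino. If they are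
    equal and exceed row [j.+2], exchanging columns [j] and [j.+1] gives a vertical domino with sign
    -1. Otherwise the determinant is 0: the lowered index meets [v j.+1] (excess 1) or [v j.+2]
    (three equal rows), or [j] is a last row of length 1 and its column vanishes. *)
Lemma sum_domino_schur :
  \sum_(rho <- young_ideal la | domino_cover rho la)
    (-1) ^+ height la rho * schur h rho
  = \sum_(j < r) jacobi_trudi h r (lower v j 2).
Proof.
apply: (@sum_removals _ la (fun rho => domino_cover rho la) (removable_domino la)
          (domino_rows la) _ (fun j => jacobi_trudi h r (lower v j 2))).
- by move=> rho; apply: domino_coverP.
- by move=> j i _; rewrite /domino_rows; case: ifP; lia.
- by move=> j; rewrite /removable_domino /domino_rows eqxx; case: ifP; lia.
- move=> j i; have := nth_part_anti la (leqnSn i).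
  rewrite /removable_domino /domino_rows; case: ifP => [/eqP eq_j|_].
    case: (i =P j) => [->|_]; first by rewrite !eqxx orbT; lia.
    by case: (i =P j.+1) => [->|_]; lia.
  by case: (i =P j) => [->|_] /=; lia.
(* If [j < k], the domino at [k] leaves row [j] unchanged while the one at [j] shortens it; symmetry
   then gives injectivity. *)
- suff lt j k : removable_domino la j ->
      (forall i, domino_rows la j i = domino_rows la k i) -> (k <= j)%N.
    by move=> j k vj vk eq_jk; apply/eqP; rewrite eqn_leq !lt // => i; rewrite eq_jk.
  move=> valid_j /(_ j); rewrite leqNgt => eq_jk; apply/negP => lt_jk.
  move: valid_j eq_jk; rewrite /removable_domino /domino_rows eqxx.
  have [/negbTE-> /negbTE->] : j != k /\ j != k.+1 by split; lia.
  by case: (row j =P _) => ?; case: ifP => _ /=; lia.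
- move=> j rho valid_j rows_rho; rewrite (domino_height valid_j rows_rho).
  have le_sz : (size rho <= r)%N.
    by apply/young_le_size/young_leP => i; rewrite rows_rho /domino_rows; case: ifP; lia.
  rewrite (schur_widen h0 le_sz).
  move: valid_j; rewrite /removable_domino; case: ifP => [/eqP eq_j|neq_j] valid_j.
    rewrite expr1 mulN1r; apply: (@jacobi_trudi_swap _ _ _ _ _ j j.+1).
    + by rewrite -nth_part_gt0; lia.
    + by rewrite -nth_part_gt0; lia.
    + by lia.
    + by rewrite /lower eqxx !rows_rho /domino_rows /v eq_j !eqxx orbT; lia.
    + by rewrite /lower !rows_rho /domino_rows /v eq_j !eqxx (gtn_eqF (ltnSn _)); lia.
    by move=> l; rewrite /lower rows_rho /domino_rows /v eq_j eqxx => /negbTE-> /negbTE->; lia.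
  rewrite expr0 mul1r; apply: eq_jacobi_trudi => i _.
  by rewrite /lower rows_rho /domino_rows neq_j /v; case: (i =P j) => [->|_] /=; lia.
move=> j /= lt_j; rewrite /removable_domino.
have le_j := nth_part_anti la (leqnSn j); have le_j1 := nth_part_anti la (leqnSn j.+1).
have gt0_j : (0 < row j)%N by rewrite nth_part_gt0.
case: ifP => [/eqP eq_j|/eqP neq_j] inv_j.
  apply: (@jacobi_trudi_eq0 _ _ _ _ j j.+2) => //; last 2 first.
  - by lia.
  - by rewrite /lower /v eqxx; case: eqP; lia.
  by rewrite -(nth_part_gt0 la); lia.
have [ge_r|lt_r] := leqP r j.+1.
  apply: (@jacobi_trudi_neg _ _ _ _ j) => //.
  by move: inv_j; rewrite /lower /v eqxx (nth_default _ ge_r); lia.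
apply: (@jacobi_trudi_eq0 _ _ _ _ j j.+1) => //; first by lia.
by rewrite /lower /v eqxx; case: eqP; lia.
Qed.

Lemma schur_rec :
  (psize la)%:R * schur h la =
  \sum_(mu <- young_ideal la | young_cover mu la)
    (a - b * (content la mu)%:~R) * schur h mu
  + c * \sum_(rho <- young_ideal la | domino_cover rho la)
      (-1) ^+ height la rho * schur h rho.
Proof.
rewrite sum_cover_schur sum_domino_schur -(jacobi_trudi_rec h1 hSS); congr (_ * _).
rewrite [LHS]pmulrn; congr (_%:~R); rewrite /psize sumnE (big_nth 0%N) big_mkord.
by rewrite -natz natr_sum; apply: eq_bigr => j _; rewrite natz subrK.
Qed.

End SchurRecurrence.

(** * Counting paths *)

Section PathCount.
Local Open Scope nat_scope.

Fixpoint paths_to (n : nat) (la : intpart) : seq (seq intpart) :=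
  if n is n'.+1 then
    [seq rcons p la | mu <- [seq mu <- young_ideal la | young_cover mu la],
                      p <- paths_to n' mu]
  else if la == empty_part then [:: [::]] else [::].

Lemma mem_paths_to n la p :
  (p \in paths_to n la) = (size p == n) && young_path la p.
Proof.
elim: n la p => [|n IHn] la p /=.
  rewrite /young_path; case: p => [|x p] /=; last by case: ifP.
  by rewrite eq_sym; case: ifP.
apply/allpairsPdep/andP.
  move=> [mu [q [+ + ->]]]; rewrite mem_filter IHn size_rcons eqSS.
  move=> /andP[cov _] /andP[-> /andP[path_q /eqP last_q]]; split=> //.
  by rewrite /young_path rcons_path last_rcons path_q last_q cov /=.
case/lastP: p => [[]//|p nu]; rewrite size_rcons eqSS /young_path rcons_path last_rcons.
move=> [sz_p /andP[/andP[path_p cov] /eqP nu_la]]; rewrite nu_la in cov *.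
exists (last empty_part p), p; split=> //; last by rewrite IHn sz_p /young_path path_p /=.
by rewrite mem_filter cov mem_young_ideal; case/andP: cov.
Qed.

(** The end point of a path to a predecessor recovers that predecessor, so no list arises from two
    of them. *)
Lemma uniq_paths_to n la : uniq (paths_to n la).
Proof.
elim: n la => [|n IHn] la /=; first by case: ifP.
apply: allpairs_uniq_dep; rewrite ?filter_uniq ?uniq_young_ideal // => u w.
move=> /allpairsPdep[mu [p [_ mem_p ->]]] /allpairsPdep[nu [q [_ mem_q ->]]] /=.
move=> E; have [eq_pq] := rcons_inj E; move: mem_p mem_q; rewrite !mem_paths_to eq_pq.
by move=> /andP[_ /andP[_ /eqP<-]] /andP[_ /andP[_ /eqP<-]].
Qed.

Lemma nb_paths_size la : nb_paths la = size (paths_to (psize la) la).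
Proof.
rewrite /nb_paths cardE -(size_map (fun t : _.-tuple _ => map val t)).
apply/perm_size/uniq_perm; rewrite ?uniq_paths_to //.
  rewrite map_inj_uniq ?enum_uniq // => t u /(inj_map val_inj) eq_tu.
  exact: val_inj.
move=> p; rewrite mem_paths_to; apply/mapP/andP.
  by move=> [t]; rewrite mem_enum inE => path_t ->; rewrite size_map size_tuple.
move=> [/eqP sz_p path_p]; have [_ sub_p] := young_path_bound path_p.
(* The path stays in [young_ideal la], so it lifts to the finite subtype over which [nb_paths]
   counts. *)
have [q eq_q] : exists q : seq (seq_sub (young_ideal la)), map val q = p.
  elim: (p) sub_p => [|x s IHs] sub_s; first by exists [::].
  have [|q <-] := IHs; first by move=> y ys; apply: sub_s; rewrite inE ys orbT.
  by exists (SeqSub (sub_s x (mem_head _ _)) :: q).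
have sz_q : size q == psize la by rewrite -sz_p -eq_q size_map.
by exists (Tuple sz_q); rewrite ?mem_enum ?inE /= eq_q.
Qed.

Lemma nb_paths_empty : nb_paths empty_part = 1.
Proof. by rewrite nb_paths_size. Qed.

Lemma psize_gt0 la : la != empty_part -> 0 < psize la.
Proof.
case: la => -[|x s] la_part; first by rewrite -val_eqE.
by have := la_part; rewrite /is_part inE negb_or /psize /=; lia.
Qed.

Lemma nb_paths_rec la :
  la != empty_part ->
  nb_paths la = \sum_(mu <- young_ideal la | young_cover mu la) nb_paths mu.
Proof.
move=> /psize_gt0; rewrite nb_paths_size; case E: (psize la) => [//|n] _.
rewrite /= size_allpairs_dep sumnE big_map big_filter; apply: eq_bigr => mu.
by move=> /andP[_ /eqP]; rewrite E nb_paths_size => -[->].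
Qed.

End PathCount.

(** * Determinants and degree vectors *)

Lemma det_scale_cols (A : comNzRingType) (n : nat) (d : 'I_n -> A) (M : 'M[A]_n) :
  \det (\matrix_(i, j) (d j * M i j)) = (\prod_j d j) * \det M.
Proof.
rewrite mulrC; have <- : \det (diag_mx (\row_j d j)) = \prod_j d j.
  by rewrite det_diag; apply: eq_bigr => j _; rewrite mxE.
rewrite -det_mulmx; congr (\det _); apply/matrixP => i j.
by rewrite mul_mx_diag !mxE mulrC.
Qed.

(** The coefficient matrix of the [p i] is lower unitriangular, and its product with the Vandermonde
    matrix is the evaluation matrix. *)
Lemma det_monic_horner (A : comNzRingType) (n : nat) (p : nat -> {poly A}) (x : 'rV[A]_n) :
  (forall i, p i \is monic) -> (forall i, size (p i) = i.+1) ->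
  \det (\matrix_(i < n, j < n) (p i).[x 0 j]) =
  \prod_(i < n) \prod_(j < n | (i < j)%N) (x 0 j - x 0 i).
Proof.
move=> p_monic size_p; rewrite -det_Vandermonde.
pose L : 'M[A]_n := \matrix_(i, k) (p i)`_k.
have -> : \matrix_(i < n, j < n) (p i).[x 0 j] = L *m Vandermonde n x.
  apply/matrixP => i j; rewrite !mxE (@horner_coef_wide _ n) ?size_p //.
  by apply: eq_bigr => k _; rewrite !mxE.
rewrite det_mulmx det_trig; last first.
  by apply/is_trig_mxP => i k lt_ik; rewrite mxE nth_default // size_p.
rewrite big1 ?mul1r // => i _; rewrite mxE.
by have /monicP := p_monic i; rewrite lead_coefE size_p.
Qed.

(* Row i of the Wronskian is row r - 1 - i of the Jacobi-Trudi matrix. *)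
Lemma schur_degree_vector (A : comNzRingType) (h : nat -> A) la :
  schur h la = (-1) ^+ perm (@rev_ord_inj (size la)) *
    \det (\matrix_(i < size la, j < size la)
            ext0 h ((degree_vector la j)%:Z - i%:Z)).
Proof.
rewrite /schur /jacobi_trudi -det_perm -det_mulmx -row_permE.
congr (\det _); apply/matrixP => i j; rewrite !mxE permE /=.
have := (ltn_ord i, ltn_ord j); rewrite /degree_vector => -[lt_i lt_j].
by congr (ext0 h _); lia.
Qed.

(** * Laguerre polynomials *)

(** The [i]-th derivative of [g n] is [g (n - i)], and 0 once [i > n], in agreement with [ext0]. *)
Lemma wronskian_appell (A : comNzRingType) (g : nat -> {poly A}) (r : nat)
    (n : 'I_r -> nat) :
  (g 0)^`() = 0 -> (forall k, (g k.+1)^`() = g k) ->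
  wronskian (fun j => g (n j)) =
  \det (\matrix_(i < r, j < r) ext0 g ((n j)%:Z - i%:Z)).
Proof.
move=> g0 gS; congr (\det _); apply/matrixP => i j; rewrite !mxE.
elim: (i : nat) => [|k IHk]; first by rewrite derivn0 subr0.
rewrite derivnS IHk; have -> : (n j)%:Z - k.+1%:Z = (n j)%:Z - k%:Z - 1 by lia.
case: ((n j)%:Z - k%:Z) => [[|m]|m].
- by rewrite /= g0.
- have -> : m.+1%:Z - 1 = m by lia.
  by rewrite /= gS.
- have -> : Negz m - 1 = Negz m.+1 by lia.
  by rewrite /= deriv0.
Qed.

Section Laguerre.
Variable R : numFieldType.

Definition inv_fact (n : nat) : R := (n`!)%:R^-1.

Lemma factr_neq0 (n : nat) : (n`!)%:R != 0 :> R.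
Proof. by rewrite pnatr_eq0 -lt0n fact_gt0. Qed.

Lemma inv_factS (n : nat) : n.+1%:R * inv_fact n.+1 = inv_fact n.
Proof. by rewrite /inv_fact factS natrM invfM mulVKf // pnatr_eq0. Qed.

(** Induction on the size: both sides are 1 at [empty_part], and with [a = 1], [b = c = 0] only the
    unweighted sum over covers survives in [schur_rec]. *)
Lemma nb_paths_schur la :
  (nb_paths la)%:R = (psize la)`!%:R * schur inv_fact la.
Proof.
have h0 : inv_fact 0 = 1 by rewrite /inv_fact invr1.
have h1 : inv_fact 1 = 1 * inv_fact 0 by rewrite mul1r.
have hSS n : n.+2%:R * inv_fact n.+2
    = (1 - 0 * n.+1%:R) * inv_fact n.+1 + 0 * inv_fact n.
  by rewrite inv_factS !mul0r subr0 addr0 mul1r.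
have [n] := ubnP (psize la); elim: n la => // n IHn la lt_n.
have [->|la_neq0] := eqVneq la empty_part.
  by rewrite nb_paths_empty /schur /jacobi_trudi det_mx00 mulr1.
rewrite nb_paths_rec // natr_sum.
have := schur_rec h0 h1 hSS la; rewrite mul0r addr0.
have := psize_gt0 la_neq0; case E: (psize la) lt_n => [//|m] lt_n _ rec.
rewrite factS natrM mulrAC rec mulrC mulr_sumr; apply: eq_bigr => mu.
move=> /andP[_]; rewrite E => /eqP[sz].
by rewrite mul0r subr0 mul1r IHn -sz.
Qed.

(** [1 / (n - i)!] is [n ^_ i / n!], and the falling factorial is a monic polynomial of degree [i]
    in [n]; pulling [1 / n!] out of each column leaves the determinant of [det_monic_horner]. *)
Lemma schur_inv_fact la :
  schur inv_fact la = (-1) ^+ perm (@rev_ord_inj (size la))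
    * (\prod_j inv_fact (degree_vector la j))
    * \prod_(i < size la) \prod_(j < size la | (i < j)%N)
        ((degree_vector la j)%:R - (degree_vector la i)%:R).
Proof.
pose p (i : nat) : {poly R} := \prod_(k < i) ('X - (k%:R)%:P).
have p_monic i : p i \is monic by apply: monic_prod => k _; apply: monicXsubC.
have size_p i : size (p i) = i.+1 by rewrite size_prod_XsubC /index_enum -enumT size_enum_ord.
have ffactE n i : (p i).[n%:R] = (n ^_ i)%:R.
  rewrite horner_prod; under eq_bigr => k _ do rewrite hornerXsubC.
  elim: i => [|i IHi]; first by rewrite big_ord0.
  rewrite big_ord_recr IHi ffactnSr natrM /=.
  have [le_in|lt_ni] := leqP i n; first by rewrite natrB.
  by rewrite ffact_small ?mul0r.
rewrite schur_degree_vector -mulrA; congr (_ * _).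
pose x : 'rV[R]_(size la) := \row_j (degree_vector la j)%:R.
have <- : \prod_(i < size la) \prod_(j < size la | (i < j)%N) (x 0 j - x 0 i)
    = \prod_(i < size la) \prod_(j < size la | (i < j)%N)
        ((degree_vector la j)%:R - (degree_vector la i)%:R).
  by apply: eq_bigr => i _; apply: eq_bigr => j _; rewrite !mxE.
rewrite -(det_monic_horner x p_monic size_p) -det_scale_cols.
congr (\det _); apply/matrixP => i j; rewrite !mxE ffactE.
move: (degree_vector la j) => n; have [le_in|lt_ni] := leqP i n; last first.
  rewrite ffact_small // mulr0.
  by case E: (_ - _) => [m|m] //; lia.
have -> : n%:Z - i%:Z = (n - i)%N by lia.
rewrite /= /inv_fact -(ffact_fact le_in) natrM invfM mulrAC mulVf ?mul1r //.
by rewrite pnatr_eq0 -lt0n ffact_gt0.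
Qed.

Variable alpha : R.

Definition appell_laguerre (n : nat) : {poly R} := inv_fact n *: mod_laguerre alpha n.

(** On coefficients this is [(k + 1) 'C(n + 1, k + 1) = (n + 1) 'C(n, k)], the product over [n - k]
    factors being common to both sides. *)
Lemma deriv_mod_laguerre (n : nat) :
  (mod_laguerre alpha n.+1)^`() = n.+1%:R *: mod_laguerre alpha n.
Proof.
apply/polyP => k; rewrite coef_deriv coefZ !coef_mod_laguerre subSS.
by rewrite -[LHS]mulr_natl !mulrA -!natrM -mul_bin_diag.
Qed.

Lemma appell_laguerreS (n : nat) : (appell_laguerre n.+1)^`() = appell_laguerre n.
Proof.
by rewrite /appell_laguerre derivZ deriv_mod_laguerre scalerA mulrC inv_factS.
Qed.

Lemma appell_laguerre0 : appell_laguerre 0 = 1.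
Proof. by rewrite /appell_laguerre mod_laguerre0 /inv_fact invr1 scale1r. Qed.

Lemma appell_laguerre1 :
  appell_laguerre 1 = ('X + alpha%:P) * appell_laguerre 0.
Proof.
by rewrite appell_laguerre0 /appell_laguerre mod_laguerre1 /inv_fact invr1 scale1r mulr1.
Qed.

Lemma appell_laguerreSS (n : nat) :
  n.+2%:R * appell_laguerre n.+2 =
    ('X + alpha%:P - 1 * n.+1%:R) * appell_laguerre n.+1 + 'X * appell_laguerre n.
Proof.
rewrite /appell_laguerre -[n.+2%:R]polyC_natr mul_polyC scalerA inv_factS.
rewrite -(inv_factS n) mod_laguerreSS -!mul_polyC !polyCM -!polyC_natr polyCB; ring.
Qed.

(** The Vandermonde factor of [schur_inv_fact] cancels the normalization, and its inverse factorials
    cancel those gained in passing to [appell_laguerre]. The sign of the row reversal is the same on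
    both sides. *)
Lemma nb_paths_wronskian_laguerre la :
  (nb_paths la)%:R * wronskian_laguerre alpha la =
  (psize la)`!%:R * schur appell_laguerre la.
Proof.
have wrE : wronskian (fun j => mod_laguerre alpha (degree_vector la j))
    = (\prod_j ((degree_vector la j)`!)%:R)
      * wronskian (fun j => appell_laguerre (degree_vector la j)).
  rewrite /wronskian -det_scale_cols; congr (\det _).
  apply/matrixP => i j; rewrite !mxE /appell_laguerre.
  move: (mod_laguerre _ _) => q; rewrite derivnZ -polyC_natr.
  by rewrite mul_polyC scalerA /inv_fact mulfV ?scale1r // factr_neq0.
rewrite /wronskian_laguerre wrE schur_degree_vector.
rewrite wronskian_appell; [|by rewrite appell_laguerre0 derivC|exact: appell_laguerreS].
rewrite -[(nb_paths la)%:R]polyC_natr nb_paths_schur schur_inv_fact.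
set V := \prod_(i < _) \prod_(j < _ | _) _; set D := \det _; set s := perm _.
have V_neq0 : V != 0.
  apply/prodf_neq0 => i _; apply/prodf_neq0 => j lt_ij.
  rewrite subr_eq0 eqr_nat /degree_vector; have := nth_part_anti la (ltnW lt_ij).
  by have := ltn_ord j; lia.
have fact_inv : (\prod_j inv_fact (degree_vector la j)) * (\prod_j (degree_vector la j)`!%:R) = 1.
  by rewrite -big_split big1 //= => j _; rewrite mulVf ?factr_neq0.
move: fact_inv; set W := \prod_j _; set F := \prod_j _ => WF.
have -> : \prod_j (degree_vector la j)`!%:R = F%:P.
  by rewrite rmorph_prod; apply: eq_bigr => j _; rewrite rmorph_nat.
have -> : (-1) ^+ s = ((-1) ^+ s)%:P :> {poly R} by rewrite rmorph_sign.
rewrite 2!mul_polyC !scalerA -polyC_natr.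
rewrite [RHS]mulrA -polyCM mul_polyC; congr (_ *: D).
by rewrite mulrA mulfK // -!mulrA WF mulr1.
Qed.

End Laguerre.

(** * Recurrence for Wronskian Laguerre polynomials *)

Theorem theorem1p1 (R : numFieldType) (alpha : R) (la : intpart)
    (la_nonempty : la != empty_part) :
  (nb_paths la)%:R * wronskian_laguerre alpha la =
    \sum_(mu <- young_ideal la | young_cover mu la)
       ('X + alpha%:P - (content la mu)%:~R)
         * (nb_paths mu)%:R * wronskian_laguerre alpha mu
    + 'X * ((psize la)%:R - 1)
      * \sum_(rho <- young_ideal la | domino_cover rho la)
          (-1) ^+ height la rho
            * (nb_paths rho)%:R * wronskian_laguerre alpha rho.
Proof.
rewrite nb_paths_wronskian_laguerre.
have [n psize_la] : exists n, psize la = n.+1.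
  by exists (psize la).-1; rewrite prednK // psize_gt0.
have rec := schur_rec (appell_laguerre0 alpha) (appell_laguerre1 alpha)
  (appell_laguerreSS alpha) la.
(* Of [(n + 1)!] the factor [n + 1] is the left factor of [rec]; the remaining [n!] goes into both
   sums and is the factorial of [psize mu] for a cover. *)
rewrite psize_la factS natrM mulrAC -psize_la mulrC rec mulrDr !mulr_sumr.
congr (_ + _).
  apply: eq_bigr => mu /andP[_]; rewrite psize_la => /eqP[sz].
  by rewrite mul1r -[RHS]mulrA nb_paths_wronskian_laguerre -sz mulrCA.
apply: eq_bigr => rho cov.
rewrite -[_ * _ * wronskian_laguerre _ _]mulrA nb_paths_wronskian_laguerre.
have /domino_coverP[j valid_j rows_rho] := cov.
(* Here [n = psize rho + 1], so [n!] is [psize la - 1] times the factorial of [psize rho]. *)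
have := domino_psize valid_j rows_rho; rewrite psize_la addn2 => -[->].
rewrite factS natrM -[_.+2%:R]natr1; ring.
Qed.
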